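(* Let $s,t,p\ge 1$, $A,B\in GL(n)$ and $Q\in\mathcal{P}(n)$ with $\lambda_1(Q)\le 1$. Put $\tilde k=\lambda_n(Q)$, $q=\min\{t/s,p/s\}$ and $\tilde q=\max\{t/s,p/s\}$. If $$\|A\|^2+\|B\|^2<\frac{q^{\tilde q}\,\tilde k^{\tilde q+1}}{(q+1)^{\tilde q+1}},$$ then the equation $X^s+A^*X^{-t}A+B^*X^{-p}B=Q$ has a Hermitian positive definite solution in $\big[\big(\tfrac{q\tilde k}{q+1}\big)^{1/s}I,\;Q^{1/s}\big]$.
   Context: $GL(n)$: $n\times n$ complex nonsingular matrices; $\mathcal{P}(n)$: $n\times n$ Hermitian positive definite matrices. For Hermitian $M$, $\lambda_1(M)$ and $\lambda_n(M)$ are its largest and smallest eigenvalues. $\|\cdot\|$ is the spectral (operator) norm. For Hermitian $P,R$, $P\le R$ means $R-P$ is positive semidefinite, and $[P,R]=\{X \text{ Hermitian}: P\le X\le R\}$. Real powers of positive definite matrices are defined by functional calculus. *)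

(* Defs.v *)
From Stdlib Require Import Reals Lra.
Open Scope R_scope.

Definition C : Type := (R * R)%type.
Definition Cre (z : C) : R := fst z.
Definition Cim (z : C) : R := snd z.
Definition RtoC (x : R) : C := (x, 0).
Definition C0 : C := (0, 0).
Definition C1 : C := (1, 0).
Definition Cadd (z w : C) : C := (fst z + fst w, snd z + snd w).
Definition Copp (z : C) : C := (- fst z, - snd z).
Definition Csub (z w : C) : C := Cadd z (Copp w).
Definition Cmul (z w : C) : C :=
  (fst z * fst w - snd z * snd w, fst z * snd w + snd z * fst w).
Definition Cconj (z : C) : C := (fst z, - snd z).
Definition Cnorm2 (z : C) : R := fst z * fst z + snd z * snd z.

Fixpoint Csum (n : nat) (f : nat -> C) : C :=
  match n with
  | O => C0
  | S m => Cadd (Csum m f) (f m)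
  end.
Fixpoint Rsum (n : nat) (f : nat -> R) : R :=
  match n with
  | O => 0
  | S m => Rsum m f + f m
  end.

(* ---------- matrices and vectors (entries with indices < n matter) ---------- *)
Definition Mat : Type := nat -> nat -> C.
Definition Vec : Type := nat -> C.

Definition meq (n : nat) (A B : Mat) : Prop :=
  forall i j, (i < n)%nat -> (j < n)%nat -> A i j = B i j.
Definition Id : Mat := fun i j => if Nat.eqb i j then C1 else C0.
Definition mscal (c : R) (A : Mat) : Mat := fun i j => Cmul (RtoC c) (A i j).
Definition madd (A B : Mat) : Mat := fun i j => Cadd (A i j) (B i j).
Definition msub (A B : Mat) : Mat := fun i j => Csub (A i j) (B i j).
Definition mmul (n : nat) (A B : Mat) : Mat :=
  fun i j => Csum n (fun k => Cmul (A i k) (B k j)).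
Definition madj (A : Mat) : Mat := fun i j => Cconj (A j i).
Definition diag (d : nat -> R) : Mat :=
  fun i j => if Nat.eqb i j then RtoC (d i) else C0.
Definition mvmul (n : nat) (A : Mat) (v : Vec) : Vec :=
  fun i => Csum n (fun k => Cmul (A i k) (v k)).

Definition vnonzero (n : nat) (v : Vec) : Prop := exists i, (i < n)%nat /\ v i <> C0.
Definition vnorm (n : nat) (v : Vec) : R := sqrt (Rsum n (fun i => Cnorm2 (v i))).
Definition quad (n : nat) (A : Mat) (v : Vec) : C :=
  Csum n (fun i => Cmul (Cconj (v i)) (mvmul n A v i)).

Definition hermitian (n : nat) (A : Mat) : Prop := meq n A (madj A).
Definition psd (n : nat) (A : Mat) : Prop :=
  hermitian n A /\ forall v : Vec, 0 <= Cre (quad n A v).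
Definition posdef (n : nat) (A : Mat) : Prop :=
  hermitian n A /\ forall v : Vec, vnonzero n v -> 0 < Cre (quad n A v).
Definition mle (n : nat) (P Q : Mat) : Prop :=
  hermitian n P /\ hermitian n Q /\ psd n (msub Q P).
Definition invertible (n : nat) (A : Mat) : Prop :=
  exists B : Mat, meq n (mmul n A B) Id /\ meq n (mmul n B A) Id.
Definition unitary (n : nat) (U : Mat) : Prop :=
  meq n (mmul n (madj U) U) Id /\ meq n (mmul n U (madj U)) Id.

(* ---------- real powers by functional calculus ----------
   is_rpow n X r Y  :<->  X is positive definite and Y = X^r, i.e.
   X = U diag(d) U^*, with U unitary, d > 0, and Y = U diag(d^r) U^*. *)
Definition is_rpow (n : nat) (X : Mat) (r : R) (Y : Mat) : Prop :=
  exists (U : Mat) (d : nat -> R),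
    unitary n U /\ (forall i, (i < n)%nat -> 0 < d i) /\
    meq n X (mmul n (mmul n U (diag d)) (madj U)) /\
    meq n Y (mmul n (mmul n U (diag (fun i => Rpower (d i) r))) (madj U)).

(* real eigenvalue (all eigenvalues of a Hermitian matrix are real) *)
Definition is_eigval (n : nat) (A : Mat) (l : R) : Prop :=
  exists v : Vec, vnonzero n v /\
    forall i, (i < n)%nat -> mvmul n A v i = Cmul (RtoC l) (v i).
Definition is_lambda_max (n : nat) (A : Mat) (k : R) : Prop :=
  is_eigval n A k /\ forall l, is_eigval n A l -> l <= k.
Definition is_lambda_min (n : nat) (A : Mat) (k : R) : Prop :=
  is_eigval n A k /\ forall l, is_eigval n A l -> k <= l.
Definition is_opnorm (n : nat) (A : Mat) (c : R) : Prop :=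
  0 <= c /\ (forall v, vnorm n (mvmul n A v) <= c * vnorm n v) /\
  (forall c', 0 <= c' -> (forall v, vnorm n (mvmul n A v) <= c' * vnorm n v) -> c <= c').

(* Main.v *)
(** With Y = X^s the equation reads Y = F(Y), F(Y) = Q - A^* Y^(-t/s) A - B^* Y^(-p/s) B.
    Write k for the smallest eigenvalue of Q, and g for the larger of t/s and p/s. The
    function y^g (k - y) is maximal at m = g k / (g + 1), so the hypothesis on the norms,
    stated at the smaller point q k / (q + 1), also holds at m. There it says two things:
    F maps the order interval [m I, Q] into itself, and F is a contraction on it for the
    Frobenius norm, because a scalar K-Lipschitz function is K-Lipschitz for that norm when
    applied to Hermitian matrices. Banach's theorem gives Y, and X = Y^(1/s) <= Q^(1/s) is
    the Loewner-Heinz inequality, proved by showing that the exponents for which it holds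
    are closed under midpoints and under limits. *)

Require Import Defs.
From Stdlib Require Import Reals Lra Lia.
Open Scope R_scope.

(** * Scalar estimates *)

Lemma Rpower_pos (x y : R) : 0 < Rpower x y.
Proof. apply exp_pos. Qed.

Lemma Rpower_mul_base (x y z : R) : 0 < x -> 0 < y ->
  Rpower (x * y) z = Rpower x z * Rpower y z.
Proof.
intros Hx Hy; unfold Rpower; rewrite ln_mult by assumption.
rewrite <- exp_plus; f_equal; ring.
Qed.

Lemma Rpower_inv_base (x z : R) : 0 < x -> Rpower (/ x) z = / Rpower x z.
Proof.
intros Hx; unfold Rpower; rewrite ln_Rinv by assumption.
rewrite <- exp_Ropp; f_equal; ring.
Qed.

Lemma Rpower_succ (x y : R) : 0 < x -> Rpower x (y + 1) = Rpower x y * x.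
Proof. intros Hx; rewrite Rpower_plus, (Rpower_1 x) by assumption; reflexivity. Qed.

Lemma Rpower_neg_le (x y r : R) : 0 <= r -> 0 < x -> x <= y ->
  Rpower y (- r) <= Rpower x (- r).
Proof.
intros Hr Hx Hxy; rewrite !Rpower_Ropp; apply Rinv_le_contravar.
- apply Rpower_pos.
- apply Rle_Rpower_l; lra.
Qed.

Lemma ln_le_sub1 (x : R) : 0 < x -> ln x <= x - 1.
Proof.
intros Hx; destruct (Req_dec (ln x) 0) as [H0 | H0].
- rewrite H0; rewrite <- (exp_ln x Hx), H0, exp_0; lra.
- generalize (exp_ineq1 (ln x) H0); rewrite (exp_ln x Hx); lra.
Qed.

Lemma Rpower_expo_le (x u v : R) : 0 < x <= 1 -> u <= v -> Rpower x v <= Rpower x u.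
Proof.
intros [Hx Hx1] Huv.
assert (Hln : ln x <= 0) by (generalize (ln_le_sub1 x Hx); lra).
unfold Rpower; destruct (Req_dec (v * ln x) (u * ln x)) as [-> | Hne]; [lra|].
left; apply exp_increasing; nra.
Qed.

(** Mean value theorem: on [c, oo) the derivative of x^(-r) is largest in absolute value at c. *)
Lemma Rpower_neg_lipschitz (c r x y : R) : 0 < c -> 0 < r -> c <= x -> c <= y ->
  Rabs (Rpower x (- r) - Rpower y (- r)) <= r * Rpower c (- r - 1) * Rabs (x - y).
Proof.
intros Hc Hr.
assert (Main : forall u v, c <= u -> u < v ->
  Rabs (Rpower u (- r) - Rpower v (- r)) <= r * Rpower c (- r - 1) * Rabs (u - v)).
{ intros u v Hu Huv.
  destruct (MVT_cor2 (fun z => Rpower z (- r)) (fun z => - r * Rpower z (- r - 1)) u v Huv)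
    as [z [Hz [Hz1 Hz2]]].
  - intros z Hz; apply derivable_pt_lim_power; lra.
  - rewrite Rabs_minus_sym, Hz, (Rabs_minus_sym u v), Rabs_mult.
    apply Rmult_le_compat_r; [apply Rabs_pos|].
    rewrite Rabs_mult, Rabs_Ropp, (Rabs_right r) by lra.
    rewrite Rabs_right by (apply Rle_ge, Rlt_le, Rpower_pos).
    apply Rmult_le_compat_l; [lra|].
    replace (- r - 1) with (- (r + 1)) by ring; apply Rpower_neg_le; lra. }
intros Hx Hy; destruct (Rtotal_order x y) as [H | [-> | H]].
- apply Main; lra.
- rewrite !Rminus_diag, Rabs_R0; lra.
- rewrite Rabs_minus_sym, (Rabs_minus_sym x y); apply Main; lra.
Qed.

(** Put m = g k / (g + 1), z = y / m and w = (k - y) / (k - m). The logarithm of the ratio of the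
    two sides is g ln z + ln w, and ln x <= x - 1 bounds it by g (z - 1) + (w - 1), which is 0 by
    the choice of m. *)
Lemma power_times_gap_max (g k y : R) : 0 < g -> 0 < k -> 0 < y < k ->
  Rpower y g * (k - y) <=
  Rpower (g * k / (g + 1)) g * (k - g * k / (g + 1)).
Proof.
intros Hg Hk [Hy Hyk]; set (m := g * k / (g + 1)).
assert (Hm : 0 < m) by (apply Rdiv_lt_0_compat; nra).
assert (Hkm : k - m = k / (g + 1)) by (unfold m; field; lra).
assert (Hkm0 : 0 < k - m) by (rewrite Hkm; apply Rdiv_lt_0_compat; lra).
set (w := (k - y) / (k - m)).
assert (Hw : 0 < w) by (apply Rdiv_lt_0_compat; lra).
assert (Hz : 0 < y / m) by (apply Rdiv_lt_0_compat; lra).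
replace y with (m * (y / m)) at 1 by (field; lra).
rewrite Rpower_mul_base by assumption.
replace (k - y) with (w * (k - m)) by (unfold w; field; lra).
assert (Hle : Rpower (y / m) g * w <= 1).
{ rewrite <- (exp_ln w Hw) at 1; unfold Rpower; rewrite <- exp_plus, <- exp_0.
  assert (Hs : g * ln (y / m) + ln w <= 0).
  { generalize (ln_le_sub1 _ Hz) (ln_le_sub1 _ Hw); intros H1 H2.
    assert (g * (y / m - 1) + (w - 1) = 0)
      by (unfold w; rewrite Hkm; unfold m; field; repeat split; nra).
    nra. }
  destruct Hs as [Hs | ->]; [left; apply exp_increasing; exact Hs | lra]. }
assert (Hmg := Rpower_pos m g).
replace (Rpower m g * Rpower (y / m) g * (w * (k - m)))
  with (Rpower m g * (k - m) * (Rpower (y / m) g * w)) by ring.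
rewrite <- (Rmult_1_r (Rpower m g * (k - m))) at 2.
apply Rmult_le_compat_l; [nra | exact Hle].
Qed.

(* The witness is [m = qt kt / (qt + 1)]. The third clause makes the order interval
   [m I, Q] invariant under the fixed point map, the fourth makes that map contracting. *)
Lemma contraction_threshold (r1 r2 kt a b : R) :
  let q := Rmin r1 r2 in let qt := Rmax r1 r2 in
  0 < r1 -> 0 < r2 -> 0 < kt <= 1 ->
  a ^ 2 + b ^ 2 < Rpower q qt * Rpower kt (qt + 1) / Rpower (q + 1) (qt + 1) ->
  exists m, 0 < m /\ q * kt / (q + 1) <= m /\
    a ^ 2 * Rpower m (- r1) + b ^ 2 * Rpower m (- r2) <= kt - m /\
    a ^ 2 * (r1 * Rpower m (- r1 - 1)) + b ^ 2 * (r2 * Rpower m (- r2 - 1)) < 1.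
Proof.
intros q qt Hr1 Hr2 [Hk Hk1] Hab.
assert (Hq : 0 < q) by (unfold q; apply Rmin_glb_lt; assumption).
assert (Hqqt : q <= qt) by (apply Rle_trans with r1; [apply Rmin_l | apply Rmax_l]).
assert (H1 : r1 <= qt) by apply Rmax_l.
assert (H2 : r2 <= qt) by apply Rmax_r.
clearbody q qt.
assert (Hal : 0 < q * kt / (q + 1)) by (apply Rdiv_lt_0_compat; nra).
assert (Hgap : kt - q * kt / (q + 1) = kt / (q + 1)) by (field; lra).
assert (Hgap0 : 0 < kt / (q + 1)) by (apply Rdiv_lt_0_compat; lra).
assert (Hmax := power_times_gap_max qt kt (q * kt / (q + 1)) ltac:(lra) Hk ltac:(lra)).
(* The bound of the theorem is the value of y^qt (kt - y) at y = q kt / (q + 1), hence at most its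
   value at the maximum point m. *)
assert (E : Rpower q qt * Rpower kt (qt + 1) / Rpower (q + 1) (qt + 1) =
            Rpower (q * kt / (q + 1)) qt * (kt - q * kt / (q + 1))).
{ rewrite Hgap; unfold Rdiv; assert (0 < / (q + 1)) by (apply Rinv_0_lt_compat; lra).
  rewrite !Rpower_mul_base, Rpower_inv_base, !Rpower_succ by nra.
  assert (Hp := Rpower_pos (q + 1) qt); field; split; lra. }
rewrite E in Hab; clear E.
set (m := qt * kt / (qt + 1)) in *.
assert (Hm : 0 < m) by (apply Rdiv_lt_0_compat; nra).
assert (Hkm : kt - m = m / qt) by (unfold m; field; lra).
(* For m <= 1 the power m^(-r) is nondecreasing in r, so both exponents can be replaced by the
   larger one, qt. *)
assert (Hm1 : m <= 1).
{ assert (0 < m / qt) by (apply Rdiv_lt_0_compat; lra); lra. }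
assert (Ham : q * kt / (q + 1) <= m).
{ assert (m - q * kt / (q + 1) = (qt - q) * kt / ((q + 1) * (qt + 1)))
    by (unfold m; field; lra).
  assert (0 <= (qt - q) * kt / ((q + 1) * (qt + 1)))
    by (apply Rmult_le_pos; [nra | left; apply Rinv_0_lt_compat; nra]).
  lra. }
assert (Hc : a ^ 2 + b ^ 2 < Rpower m qt * (kt - m)) by lra.
assert (Ha := pow2_ge_0 a); assert (Hb := pow2_ge_0 b).
assert (Hmq := Rpower_pos m qt).
assert (Hinv : Rpower m (- qt) * Rpower m qt = 1)
  by (rewrite <- Rpower_plus, Rplus_opp_l; apply Rpower_O; exact Hm).
assert (Hmq' := Rpower_pos m (- qt)).
assert (Hc1 : (a ^ 2 + b ^ 2) * Rpower m (- qt) < kt - m).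
{ replace (kt - m) with (Rpower m qt * (kt - m) * Rpower m (- qt))
    by (rewrite <- (Rmult_1_l (kt - m)) at 2; rewrite <- Hinv; ring).
  apply Rmult_lt_compat_r; assumption. }
exists m; split; [exact Hm | split; [exact Ham | split]].
- assert (P1 := Rpower_expo_le m (- qt) (- r1) ltac:(lra) ltac:(lra)).
  assert (P2 := Rpower_expo_le m (- qt) (- r2) ltac:(lra) ltac:(lra)).
  nra.
- assert (Bd : forall r, 0 < r -> r <= qt ->
    r * Rpower m (- r - 1) <= qt * (Rpower m (- qt) / m)).
  { intros r Hr Hrq.
    assert (P := Rpower_expo_le m (- qt - 1) (- r - 1) ltac:(lra) ltac:(lra)).
    replace (Rpower m (- qt) / m) with (Rpower m (- qt - 1)).
    - apply Rmult_le_compat; try lra; left; apply Rpower_pos.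
    - unfold Rminus; rewrite Rpower_plus, (Rpower_Ropp m 1), Rpower_1 by assumption.
      reflexivity. }
  assert (B1 := Bd r1 Hr1 H1); assert (B2 := Bd r2 Hr2 H2).
  apply Rle_lt_trans with ((a ^ 2 + b ^ 2) * (qt * (Rpower m (- qt) / m))); [nra|].
  replace ((a ^ 2 + b ^ 2) * (qt * (Rpower m (- qt) / m)))
    with ((a ^ 2 + b ^ 2) * Rpower m (- qt) * (qt / m)) by (field; lra).
  (* At the maximum point kt - m = m / qt, so the inequality that gives invariance, scaled by qt /
     m, also gives a contraction constant below 1. *)
  replace 1 with ((kt - m) * (qt / m)) by (rewrite Hkm; field; lra).
  apply Rmult_lt_compat_r; [apply Rdiv_lt_0_compat; lra | exact Hc1].
Qed.

(** * Geometric sequences and bisection *)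

Lemma geometric_le_0 (x c L : R) : 0 <= L < 1 -> (forall m : nat, x <= c * L ^ m) -> x <= 0.
Proof.
intros HL H; destruct (Rle_or_lt x 0) as [|Hx]; [assumption|exfalso].
assert (Hc : 0 < c) by (generalize (H O); simpl; lra).
destruct (pow_lt_1_zero L ltac:(rewrite Rabs_right; lra) (x / c)
            ltac:(apply Rdiv_lt_0_compat; assumption)) as [N HN].
specialize (HN N (le_n N)); specialize (H N).
assert (L ^ N < x / c) by (eapply Rle_lt_trans; [apply Rle_abs | exact HN]).
assert (c * L ^ N < c * (x / c)) by (apply Rmult_lt_compat_l; assumption).
replace (c * (x / c)) with x in * by (field; lra); lra.
Qed.

(** The sequence is Cauchy because its tails are dominated by those of a geometric series. The
    explicit rate is kept because later limit arguments use it instead of a topology. *)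
Lemma geometric_increments_cv (u : nat -> R) (c L : R) : 0 <= L < 1 ->
  (forall m, Rabs (u (S m) - u m) <= c * L ^ m) ->
  exists l, forall m, Rabs (u m - l) <= c / (1 - L) * L ^ m.
Proof.
intros HL Hu.
assert (Hc : 0 <= c).
{ specialize (Hu O); simpl in Hu; generalize (Rabs_pos (u 1%nat - u O)); lra. }
set (K := c / (1 - L)).
assert (HK : 0 <= K) by (apply Rmult_le_pos; [lra | left; apply Rinv_0_lt_compat; lra]).
assert (HKL : c = K * (1 - L)) by (unfold K; field; lra).
assert (Hpos : forall m, 0 <= L ^ m) by (intros; apply pow_le; lra).
(* The subtracted term K L^(m + k) makes the induction telescope, since K L^j - K L^(j + 1) = c
   L^j. *)
assert (Htail : forall m k, Rabs (u (m + k)%nat - u m) <= K * L ^ m - K * L ^ (m + k)).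
{ intros m k; induction k as [|k IH].
  - rewrite Nat.add_0_r, !Rminus_diag, Rabs_R0; lra.
  - rewrite Nat.add_succ_r; specialize (Hu (m + k)%nat).
    replace (u (S (m + k)) - u m)
      with ((u (S (m + k)) - u (m + k)%nat) + (u (m + k)%nat - u m)) by ring.
    eapply Rle_trans; [apply Rabs_triang|]; simpl; nra. }
assert (Htail' : forall m k, (m <= k)%nat -> Rabs (u k - u m) <= K * L ^ m).
{ intros m k Hmk; replace k with (m + (k - m))%nat by lia.
  generalize (Htail m (k - m)%nat) (Hpos (m + (k - m))%nat); intros; nra. }
assert (Hsmall : forall eps, 0 < eps -> exists N, forall m, (N <= m)%nat -> K * L ^ m < eps).
{ intros eps Heps.
  destruct (pow_lt_1_zero L ltac:(rewrite Rabs_right; lra) (eps / (K + 1))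
              ltac:(apply Rdiv_lt_0_compat; lra)) as [N HN].
  exists N; intros m Hm; specialize (HN m Hm).
  rewrite Rabs_right in HN by (apply Rle_ge, Hpos).
  assert ((K + 1) * L ^ m < (K + 1) * (eps / (K + 1)))
    by (apply Rmult_lt_compat_l; [lra | exact HN]).
  replace ((K + 1) * (eps / (K + 1))) with eps in * by (field; lra).
  specialize (Hpos m); lra. }
assert (Hcau : Cauchy_crit u).
{ intros eps Heps; destruct (Hsmall (eps / 2) ltac:(lra)) as [N HN].
  exists N; intros i j Hi Hj; unfold Rdist.
  replace (u i - u j) with ((u i - u N) - (u j - u N)) by ring.
  specialize (HN N (le_n N)).
  generalize (Htail' N i Hi) (Htail' N j Hj); intros.
  unfold Rminus at 1; eapply Rle_lt_trans; [apply Rabs_triang|].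
  rewrite Rabs_Ropp; lra. }
destruct (R_complete u Hcau) as [l Hl]; exists l; intros m.
apply le_epsilon; intros eps Heps.
destruct (Hl eps Heps) as [N HN].
specialize (HN (Nat.max N m) ltac:(lia)); unfold Rdist in HN.
generalize (Htail' m (Nat.max N m) ltac:(lia)); intros Ht.
replace (u m - l) with (- (u (Nat.max N m) - u m) + (u (Nat.max N m) - l)) by ring.
eapply Rle_trans; [apply Rabs_triang|]; rewrite Rabs_Ropp; lra.
Qed.

(** Bisection of [0, 1] around x keeps both end points in J, so points of J come arbitrarily close
    to x and continuity carries the sign of phi to x. *)
Lemma midpoint_closed_nonneg (J : R -> Prop) (phi : R -> R) (x : R) :
  J 0 -> J 1 -> (forall a b, J a -> J b -> J ((a + b) / 2)) ->
  continuity phi -> (forall a, J a -> 0 <= phi a) -> 0 <= x <= 1 -> 0 <= phi x.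
Proof.
intros J0 J1 Jmid Hphi Jphi Hx.
assert (Hbis : forall k : nat, exists l u, J l /\ J u /\ l <= x <= u /\ u - l = (1 / 2) ^ k).
{ induction k as [|k (l & u & Jl & Ju & Hlu & Hk)].
  - exists 0, 1; simpl; intuition lra.
  - assert (Jm := Jmid l u Jl Ju); simpl; rewrite <- Hk.
    destruct (Rle_or_lt x ((l + u) / 2)).
    + exists l, ((l + u) / 2); intuition lra.
    + exists ((l + u) / 2), u; intuition lra. }
destruct (Rle_or_lt 0 (phi x)) as [|Hneg]; [assumption|exfalso].
destruct (Hphi x (- phi x) ltac:(lra)) as [del [Hdel Hnear]].
destruct (pow_lt_1_zero (1 / 2) ltac:(rewrite Rabs_right; lra) del Hdel) as [N HN].
specialize (HN N (le_n N)).
rewrite Rabs_right in HN by (apply Rle_ge, pow_le; lra).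
destruct (Hbis N) as (l & u & Jl & _ & Hlu & Hk).
(* The limit behind [continuity] excludes the point x itself, so l = x is a separate case. *)
destruct (Req_dec x l) as [-> | Hne]; [specialize (Jphi l Jl); lra|].
specialize (Hnear l); simpl in Hnear; unfold Rdist, D_x, no_cond in Hnear.
assert (Hl : Rabs (phi l - phi x) < - phi x).
{ apply Hnear; split; [split; [exact I | exact Hne]|].
  rewrite Rabs_minus_sym, Rabs_right; lra. }
specialize (Jphi l Jl); rewrite Rabs_right in Hl; lra.
Qed.

Lemma Rpower_root_neg (x s r : R) : s <> 0 ->
  Rpower (Rpower x (1 / s)) (- r) = Rpower x (- (r / s)).
Proof. intros Hs; rewrite Rpower_mult; f_equal; field; exact Hs. Qed.

Lemma Rpower_root_cancel (x s : R) : 0 < x -> s <> 0 -> Rpower (Rpower x (1 / s)) s = x.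
Proof.
intros Hx Hs; rewrite Rpower_mult; replace (1 / s * s) with 1 by (field; exact Hs).
apply Rpower_1; exact Hx.
Qed.

From mathcomp Require Import all_boot all_order all_algebra.
From mathcomp Require Import spectral complex Rstruct.
From mathcomp Require ring lra.

Set Implicit Arguments.
Unset Strict Implicit.
Unset Printing Implicit Defensive.

(** * Frobenius inner product and unitary diagonalisation *)

Section LinearAlgebra.
Import Order.TTheory GRing.Theory Num.Theory.
Import mathcomp.algebra_tactics.ring mathcomp.algebra_tactics.lra.
Local Open Scope ring_scope.
Local Open Scope sesquilinear_scope.
Local Open Scope complex_scope.

Variable R : rcfType.
Local Notation C := R[i].
Local Notation Re := (@complex.Re R).
Local Notation Im := (@complex.Im R).

(** The real part of the trace of M N^*, written with real entries so that all inequalities live in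
    the ordered field R. For a column v, [dot v (Y *m v)] is the quadratic form of Y. *)
Definition dot m n (M N : 'M[C]_(m, n)) : R :=
  \sum_i \sum_j (Re (M i j) * Re (N i j) + Im (M i j) * Im (N i j)).

Lemma Re_sum (I : Type) (r : seq I) (P : pred I) (F : I -> C) :
  Re (\sum_(i <- r | P i) F i) = \sum_(i <- r | P i) Re (F i).
Proof. by apply: (big_morph Re) => // -[a b] [c d]. Qed.

Lemma dotE m n (M N : 'M[C]_(m, n)) : dot M N = Re (\tr (M *m N^t*)).
Proof.
rewrite /mxtrace Re_sum; apply: eq_bigr => i _.
rewrite mxE Re_sum; apply: eq_bigr => j _; rewrite !mxE.
case: (M i j) (N i j) => a b [c d].
by rewrite -[(_ +i* d)^*%R]/(c -i* d)%C /= mulrN opprK.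
Qed.

Lemma adjmxM m n p (M : 'M[C]_(m, n)) (N : 'M[C]_(n, p)) :
  (M *m N)^t* = N^t* *m M^t*.
Proof. by rewrite trmx_mul map_mxM. Qed.

Lemma adjmxD m n (M N : 'M[C]_(m, n)) : (M + N)^t* = M^t* + N^t*.
Proof. by rewrite linearD map_mxD. Qed.

Lemma adjmxN m n (M : 'M[C]_(m, n)) : (- M)^t* = - M^t*.
Proof. by rewrite linearN map_mxN. Qed.

Lemma adjmxZ m n (c : R) (M : 'M[C]_(m, n)) : (c%:C *: M)^t* = c%:C *: M^t*.
Proof.
by rewrite linearZ /= map_mxZ; congr (_ *: _); rewrite -[LHS]/(conjc c%:C) conjc_real.
Qed.

Lemma dotC m n (M N : 'M[C]_(m, n)) : dot M N = dot N M.
Proof.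
by apply: eq_bigr => i _; apply: eq_bigr => j _; congr (_ + _); rewrite mulrC.
Qed.

Lemma dotDl m n (M M' N : 'M[C]_(m, n)) : dot (M + M') N = dot M N + dot M' N.
Proof.
rewrite /dot -big_split; apply: eq_bigr => i _ /=.
rewrite -big_split; apply: eq_bigr => j _ /=; rewrite mxE.
by case: (M i j) (M' i j) => a b [c d] /=; ring.
Qed.

Lemma dotZl m n (c : R) (M N : 'M[C]_(m, n)) : dot (c%:C *: M) N = c * dot M N.
Proof.
rewrite /dot big_distrr; apply: eq_bigr => i _ /=.
rewrite big_distrr; apply: eq_bigr => j _ /=; rewrite mxE.
by case: (M i j) => a b /=; ring.
Qed.

Lemma dotDr m n (M N N' : 'M[C]_(m, n)) : dot M (N + N') = dot M N + dot M N'.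
Proof. by rewrite dotC dotDl !(dotC M). Qed.

Lemma dotZr m n (c : R) (M N : 'M[C]_(m, n)) : dot M (c%:C *: N) = c * dot M N.
Proof. by rewrite dotC dotZl dotC. Qed.

Lemma dotNl m n (M N : 'M[C]_(m, n)) : dot (- M) N = - dot M N.
Proof.
have -> : - M = (-1)%:C *: M by rewrite rmorphN1 scaleN1r.
by rewrite dotZl mulN1r.
Qed.

Lemma dotNr m n (M N : 'M[C]_(m, n)) : dot M (- N) = - dot M N.
Proof. by rewrite dotC dotNl dotC. Qed.

Lemma dot_mull m n p (A : 'M[C]_(m, n)) (M : 'M[C]_(n, p)) N :
  dot (A *m M) N = dot M (A^t* *m N).
Proof. by rewrite !dotE adjmxM trmxCK -mulmxA mxtrace_mulC mulmxA. Qed.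

Lemma dot_mulr m n p (A : 'M[C]_(n, p)) (M : 'M[C]_(m, n)) N :
  dot (M *m A) N = dot M (N *m A^t*).
Proof. by rewrite !dotE adjmxM trmxCK mulmxA. Qed.

Lemma dot_adj m n (M N : 'M[C]_(m, n)) : dot (M^t*) (N^t*) = dot M N.
Proof. by rewrite dotC !dotE trmxCK mxtrace_mulC. Qed.

Lemma dot_ge0 m n (M : 'M[C]_(m, n)) : 0 <= dot M M.
Proof.
by apply: sumr_ge0 => i _; apply: sumr_ge0 => j _; rewrite -!expr2 addr_ge0 ?sqr_ge0.
Qed.

Lemma entry_sq_le_dot m n (M : 'M[C]_(m, n)) i j :
  Re (M i j) ^+ 2 + Im (M i j) ^+ 2 <= dot M M.
Proof.
have sq_ge0 k l : 0 <= Re (M k l) * Re (M k l) + Im (M k l) * Im (M k l).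
  by rewrite -!expr2 addr_ge0 ?sqr_ge0.
rewrite /dot (bigD1 i) //= (bigD1 j) //= -!expr2 -addrA lerDl addr_ge0 //.
  by apply: sumr_ge0.
by apply: sumr_ge0 => k _; apply: sumr_ge0.
Qed.

Lemma dot_eq0 m n (M : 'M[C]_(m, n)) : dot M M = 0 -> M = 0.
Proof.
move=> M0; apply/matrixP => i j; rewrite mxE.
have := entry_sq_le_dot M i j; rewrite M0; case: (M i j) => a b /= ab.
by congr (_ +i* _); nra.
Qed.

(** * The Frobenius norm and operator bounds *)

Definition fro m n (M : 'M[C]_(m, n)) : R := Num.sqrt (dot M M).

Lemma fro_ge0 m n (M : 'M[C]_(m, n)) : 0 <= fro M.
Proof. exact: sqrtr_ge0. Qed.

Lemma fro_sq m n (M : 'M[C]_(m, n)) : fro M ^+ 2 = dot M M.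
Proof. by rewrite sqr_sqrtr ?dot_ge0. Qed.

Lemma fro_eq0 m n (M : 'M[C]_(m, n)) : fro M = 0 -> M = 0.
Proof. by move=> M0; apply: dot_eq0; rewrite -fro_sq M0 expr0n. Qed.

Lemma dot0l m n (N : 'M[C]_(m, n)) : dot 0 N = 0.
Proof. by rewrite -[0](scale0r 0) (_ : 0 = 0%:C) // dotZl mul0r. Qed.

Lemma dot_le_fro m n (M N : 'M[C]_(m, n)) : dot M N <= fro M * fro N.
Proof.
have pos (c : R) : 0 <= dot M M - 2 * c * dot M N + c ^+ 2 * dot N N.
  suff <- : dot (M - c%:C *: N) (M - c%:C *: N) =
            dot M M - 2 * c * dot M N + c ^+ 2 * dot N N by exact: dot_ge0.
  by rewrite !(dotDl, dotDr, dotNl, dotNr, dotZl, dotZr) (dotC N M); ring.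
have [/fro_eq0-> | N0] := eqVneq (fro N) 0.
  by rewrite dotC dot0l mulr_ge0 ?fro_ge0.
have [/fro_eq0-> | M0] := eqVneq (fro M) 0.
  by rewrite dot0l mulr_ge0 ?fro_ge0.
have Np : 0 < fro N by rewrite lt_def N0 fro_ge0.
have Mp : 0 < fro M by rewrite lt_def M0 fro_ge0.
(* This c gives c N the norm of M, and the quadratic becomes a positive multiple of the gap in
   Cauchy-Schwarz. *)
have := pos (fro M / fro N); rewrite -!fro_sq.
rewrite (_ : _ + _ = 2 * fro M * (fro M * fro N - dot M N) / fro N); last by field.
by rewrite pmulr_lge0 ?invr_gt0 // pmulr_rge0 ?subr_ge0 // mulr_gt0.
Qed.

Lemma fro_le m n m' n' (M : 'M[C]_(m, n)) (N : 'M[C]_(m', n')) (a : R) :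
  0 <= a -> dot M M <= a ^+ 2 * dot N N -> fro M <= a * fro N.
Proof.
by move=> a0 MN; rewrite -ler_sqr ?nnegrE ?mulr_ge0 ?fro_ge0 // exprMn !fro_sq.
Qed.

Lemma froD m n (M N : 'M[C]_(m, n)) : fro (M + N) <= fro M + fro N.
Proof.
rewrite -ler_sqr ?nnegrE ?addr_ge0 ?fro_ge0 // fro_sq dotDl !dotDr sqrrD !fro_sq.
by have := dot_le_fro M N; rewrite (dotC N M); lra.
Qed.

Lemma fro_adj m n (M : 'M[C]_(m, n)) : fro (M^t*) = fro M.
Proof. by rewrite /fro dot_adj. Qed.

(** For a >= 0 this says that the operator norm is at most a; squaring avoids roots. *)
Definition opbound m n (A : 'M[C]_(m, n)) (a : R) :=
  forall v : 'cV[C]_n, dot (A *m v) (A *m v) <= a ^+ 2 * dot v v.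

(** With w = A^* v, |w|^2 is the inner product of v and A w, hence at most a |w| |v|; a factor |w|
    cancels. *)
Lemma opbound_adj m n (A : 'M[C]_(m, n)) a : 0 <= a -> opbound A a -> opbound (A^t*) a.
Proof.
move=> a0 Aa v; set w := A^t* *m v.
have Aw : fro (A *m w) <= a * fro w.
  rewrite -ler_sqr ?nnegrE ?mulr_ge0 ?fro_ge0 // exprMn !fro_sq; exact: Aa.
have ww : fro w ^+ 2 <= a * fro w * fro v.
  rewrite fro_sq {1}/w dot_mull trmxCK dotC (le_trans (dot_le_fro _ _)) //.
  by rewrite ler_wpM2r ?fro_ge0.
rewrite -!fro_sq -exprMn ler_sqr ?nnegrE ?mulr_ge0 ?fro_ge0 //.
have [-> | w0] := eqVneq (fro w) 0; first by rewrite mulr_ge0 ?fro_ge0.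
have wp : 0 < fro w by rewrite lt_def w0 fro_ge0.
by rewrite -(ler_pM2l wp); nra.
Qed.

Lemma dot_col m n (M : 'M[C]_(m, n)) : dot M M = \sum_j dot (col j M) (col j M).
Proof.
rewrite /dot exchange_big; apply: eq_bigr => j _; apply: eq_bigr => i _.
by rewrite big_ord1 !mxE.
Qed.

(** The squared Frobenius norm is the sum over the columns, and the operator bound applies to each
    column. *)
Lemma fro_mull m n p (A : 'M[C]_(m, n)) a (M : 'M[C]_(n, p)) :
  0 <= a -> opbound A a -> fro (A *m M) <= a * fro M.
Proof.
move=> a0 Aa; apply: fro_le => //; rewrite dot_col (dot_col M) big_distrr ler_sum //= => j _.
by rewrite colE -mulmxA -colE Aa.
Qed.

(** Taking adjoints turns the right factor into a left one, so A and A^* each cost one factor a. *)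
Lemma fro_sandwich n (A M : 'M[C]_n) a : 0 <= a -> opbound A a ->
  fro (A^t* *m M *m A) <= a ^+ 2 * fro M.
Proof.
move=> a0 Aa; have Aa' := opbound_adj a0 Aa.
rewrite -mulmxA (le_trans (fro_mull _ a0 Aa')) // expr2 -mulrA ler_wpM2l //.
by rewrite -fro_adj adjmxM -[in leRHS]fro_adj fro_mull.
Qed.

(** * Unitary diagonalisation with real eigenvalues *)

Definition udiag n (U : 'M[C]_n) (d : 'I_n -> R) : 'M[C]_n :=
  U^t* *m diag_mx (\row_i (d i)%:C) *m U.

Lemma adj_diag_real n (d : 'I_n -> R) :
  (diag_mx (\row_i (d i)%:C))^t* = diag_mx (\row_i (d i)%:C).
Proof.
apply/matrixP => i j; rewrite !mxE eq_sym; case: eqVneq => [->|_].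
  by rewrite !mulr1n -[LHS]/(conjc _) conjc_real.
by rewrite !mulr0n -[LHS]/(conjc _) conjc0.
Qed.

Lemma udiag_herm n (U : 'M[C]_n) d : (udiag U d)^t* = udiag U d.
Proof. by rewrite !adjmxM trmxCK adj_diag_real mulmxA. Qed.

Lemma unitarymx_mulVmx n (U : 'M[C]_n) : U \is unitarymx -> U^t* *m U = 1%:M.
Proof. by move=> Uu; rewrite -(invmx_unitary Uu) mulVmx ?unitarymx_unit. Qed.

Lemma udiagM n (U : 'M[C]_n) d e : U \is unitarymx ->
  udiag U d *m udiag U e = udiag U (fun i => d i * e i).
Proof.
move=> Uu; have -> : udiag U d *m udiag U e =
    U^t* *m (diag_mx (\row_i (d i)%:C) *m (U *m U^t*)
             *m diag_mx (\row_i (e i)%:C)) *m U by rewrite /udiag !mulmxA.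
rewrite (unitarymxP Uu) mulmx1 mulmx_diag.
apply: (congr1 (fun r => U^t* *m diag_mx r *m U)).
by apply/rowP => i; rewrite !mxE rmorphM.
Qed.

Lemma udiag_cst n (U : 'M[C]_n) (c : R) : U \is unitarymx ->
  udiag U (fun=> c) = c%:C%:M.
Proof.
move=> Uu; rewrite /udiag (_ : diag_mx _ = c%:C%:M).
  by rewrite mul_mx_scalar -scalemxAl unitarymx_mulVmx // scalemx1.
by rewrite -diag_const_mx; congr diag_mx; apply/rowP => i; rewrite !mxE.
Qed.

Lemma eq_udiag n (U : 'M[C]_n) d e : d =1 e -> udiag U d = udiag U e.
Proof.
move=> de; apply: (congr1 (fun r => U^t* *m diag_mx r *m U)).
by apply/rowP => i; rewrite !mxE de.
Qed.

(** Squared moduli of the coordinates of v in the eigenbasis: the quadratic form of [udiag U d] is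
    the sum of the d i with these weights. *)
Definition weight n (U : 'M[C]_n) (v : 'cV[C]_n) (i : 'I_n) : R :=
  Re ((U *m v) i 0) ^+ 2 + Im ((U *m v) i 0) ^+ 2.

Lemma weight_ge0 n (U : 'M[C]_n) v i : 0 <= weight U v i.
Proof. by rewrite addr_ge0 ?sqr_ge0. Qed.

Lemma dot_udiag n (U : 'M[C]_n) d v :
  dot v (udiag U d *m v) = \sum_i d i * weight U v i.
Proof.
rewrite /udiag -!mulmxA -dot_mull; apply: eq_bigr => i _.
rewrite big_ord1 (_ : (diag_mx _ *m _) i 0 = (d i)%:C * (U *m v) i 0).
  by rewrite /weight; case: ((U *m v) i 0) => a b /=; ring.
by rewrite mul_diag_mx mxE mxE.
Qed.

Lemma dot_weight n (U : 'M[C]_n) v : U \is unitarymx ->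
  dot v v = \sum_i weight U v i.
Proof.
move=> Uu; have := dot_udiag U (fun=> 1) v.
rewrite udiag_cst // mul1mx => ->; by apply: eq_bigr => i _; rewrite mul1r.
Qed.

Lemma udiag_eigenvector n (U : 'M[C]_n) d i : U \is unitarymx ->
  udiag U d *m col i (U^t*) = (d i)%:C *: col i (U^t*).
Proof.
move=> Uu; rewrite colE /udiag mulmxA mulmxtVK // -mulmxA scalemxAr.
congr (_ *m _); rewrite mul_diag_mx; apply/colP => j; rewrite !mxE.
by case: eqVneq => [->|] //; rewrite !mulr0.
Qed.

Lemma dot_unitary_col n (U : 'M[C]_n) i : U \is unitarymx ->
  dot (col i (U^t*)) (col i (U^t*)) = 1.
Proof.
move=> Uu.
have -> : col i (U^t*) = U^t* *m delta_mx i 0 by rewrite colE.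
rewrite dot_mull trmxCK mulmxA (unitarymxP Uu) mul1mx /dot.
rewrite (bigD1 i) //= [X in _ + X]big1 => [|k ki]; rewrite big_ord1 !mxE.
  by rewrite !eqxx /= mulr1 mulr0 !addr0.
by rewrite (negPf ki) /= mulr0 addr0.
Qed.

(** For Hermitian Y the spectral diagonal is real, so taking real parts loses nothing. *)
Definition ev n (Y : 'M[C]_n) (i : 'I_n) : R := Re (spectral_diag Y 0 i).

Lemma spectral_udiag n (Y : 'M[C]_n) : Y^t* = Y -> Y = udiag (spectralmx Y) (ev Y).
Proof.
move=> Yh; have Yherm : Y \is hermsymmx.
  by apply/is_hermitianmxP; rewrite expr0 scale1r.
have := hermitian_spectral_diag_real Yherm => dreal.
rewrite {1}[Y](orthomx_spectralP (hermitian_normalmx Yherm)).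
rewrite (invmx_unitary (spectral_unitarymx Y)).
apply: (congr1 (fun r => (spectralmx Y)^t* *m diag_mx r *m spectralmx Y)).
apply/rowP => i; rewrite !mxE RRe_real //; by move/mxOverP: dreal => ->.
Qed.

Lemma fro_unitaryl n m (U : 'M[C]_n) (M : 'M[C]_(n, m)) :
  U \is unitarymx -> fro (U *m M) = fro M.
Proof. by move=> Uu; rewrite /fro dot_mull mulmxA unitarymx_mulVmx ?mul1mx. Qed.

Lemma fro_unitaryr n m (U : 'M[C]_n) (M : 'M[C]_(m, n)) :
  U \is unitarymx -> fro (M *m U) = fro M.
Proof. by move=> Uu; rewrite /fro dot_mulr -mulmxA (unitarymxP Uu) mulmx1. Qed.

(* In the mixed eigenbasis the (i, j) entry of f(X) - f(Y) is (f(d i) - f(e j)) W i j. *)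
Lemma fro_udiag_lipschitz n (U V : 'M[C]_n) (d e fd fe : 'I_n -> R) (K : R) :
  U \is unitarymx -> V \is unitarymx -> 0 <= K ->
  (forall i j, `|fd i - fe j| <= K * `|d i - e j|) ->
  fro (udiag U fd - udiag V fe) <= K * fro (udiag U d - udiag V e).
Proof.
move=> Uu Vu K0 fK.
have V'u : V^t* \is unitarymx by rewrite trmxC_unitary.
have inv M : fro M = fro (U *m M *m V^t*).
  by rewrite (fro_unitaryr (U *m M) V'u) (fro_unitaryl M Uu).
have mixed (x y : 'I_n -> R) : U *m (udiag U x - udiag V y) *m V^t* =
    \matrix_(i, j) ((x i - y j)%:C * (U *m V^t*) i j).
  have -> : U *m (udiag U x - udiag V y) *m V^t* =
      (U *m U^t*) *m (diag_mx (\row_i (x i)%:C) *m (U *m V^t*)) -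
      (U *m V^t*) *m diag_mx (\row_i (y i)%:C) *m (V *m V^t*).
    by rewrite /udiag mulmxBr mulmxBl !mulmxA.
  rewrite (unitarymxP Uu) (unitarymxP Vu) mul1mx mulmx1.
  move: (U *m V^t*) => W; rewrite mul_diag_mx mul_mx_diag; apply/matrixP => i j.
  by rewrite !mxE rmorphB mulrBl [X in _ - X]mulrC.
have key x y := etrans (inv _) (congr1 (@fro n n) (mixed x y)).
have leE a b a' b' : a = a' -> b = b' -> a' <= K * b' -> a <= K * b by move=> -> ->.
apply: (leE _ _ _ _ (key fd fe) (key d e)); move: inv mixed key leE => _ _ _ _.
 move: (U *m V^t*) => W; clear -K0 fK.
apply: fro_le => //; rewrite /dot big_distrr ler_sum //= => i _.
rewrite big_distrr ler_sum //= => j _; rewrite !mxE; case: (W i j) => a b /=.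
have le2 : (fd i - fe j) ^+ 2 <= K ^+ 2 * (d i - e j) ^+ 2.
  rewrite -real_normK ?num_real // -(real_normK (num_real (d i - e j))) -exprMn.
  by rewrite ler_sqr ?nnegrE ?mulr_ge0.
have ab : 0 <= a ^+ 2 + b ^+ 2 by rewrite addr_ge0 ?sqr_ge0.
have := ler_wpM2r ab le2; lra.
Qed.

(* An eigenvector e of K X1 X2 K for nu gives w := K e with X1 X2 w = nu Y1 Y2 w, and
   Cauchy-Schwarz together with the two hypotheses on norms then bounds nu by 1. *)
Lemma midpoint_mx n (X1 X2 Y1 Y2 Z1 Z2 G K : 'M[C]_n) :
  X1^t* = X1 -> X2^t* = X2 -> X1 *m X2 = X2 *m X1 -> Y1^t* = Y1 ->
  G^t* = G -> K^t* = K -> G *m K = 1%:M -> Y1 *m Z1 = 1%:M -> Z2 *m Y2 = 1%:M ->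
  G *m G = Y1 *m Y2 ->
  (forall v : 'cV[C]_n, fro (X1 *m v) <= fro (Y1 *m v)) ->
  (forall v : 'cV[C]_n, fro (X2 *m v) <= fro (Y2 *m v)) ->
  forall v : 'cV[C]_n, dot v (X1 *m X2 *m v) <= dot v (Y1 *m Y2 *m v).
Proof.
move=> X1h X2h X12 Y1h Gh Kh GK YZ1 ZY2 GG le1 le2.
have KG : K *m G = 1%:M by apply: mulmx1C.
have Hh : (K *m (X1 *m X2) *m K)^t* = K *m (X1 *m X2) *m K.
  by rewrite !adjmxM Kh X1h X2h -X12 mulmxA.
set H := K *m (X1 *m X2) *m K in Hh.
have HE := spectral_udiag Hh; have Wu := spectral_unitarymx H.
have ev1 i : ev H i <= 1.
  set nu := ev H i; set e := col i ((spectralmx H)^t*).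
  have He : H *m e = nu%:C *: e by rewrite {1}HE udiag_eigenvector.
  have e1 : dot e e = 1 by exact: dot_unitary_col.
  move: nu e He e1 => nu e He e1.
  (* The vector u' is chosen so that Y1 u' = u. Then nu |u|^2 is the inner product of X2 w and X1
     u', at most |Y2 w| |Y1 u'| = |u|^2. *)
  pose w := K *m e; pose u := Y2 *m w; pose u' := Z1 *m u.
  have Yu : Y1 *m u = G *m e by rewrite /u /w !mulmxA -GG -(mulmxA G) GK mulmx1.
  have Xw : X1 *m (X2 *m w) = nu%:C *: (Y1 *m u).
    by rewrite Yu scalemxAr -He /H /w -2!(mulmxA K) (mulmxA G) GK mul1mx !mulmxA.
  have u'1 : Y1 *m u' = u by rewrite /u' mulmxA YZ1 mul1mx.
  have nuu : nu * fro u ^+ 2 <= fro u ^+ 2.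
    have -> : nu * fro u ^+ 2 = dot (X2 *m w) (X1 *m u').
      by rewrite dotC dot_mull X1h Xw dotZr dotC dot_mull Y1h u'1 fro_sq.
    apply: le_trans (dot_le_fro _ _) _; rewrite expr2.
    apply: ler_pM; [exact: fro_ge0|exact: fro_ge0|exact: le2|].
    by apply: le_trans (le1 _) _; rewrite u'1.
  have [/fro_eq0 u0 | u0] := eqVneq (fro u) 0.
    suff e0 : e = 0 by move: e1; rewrite e0 dot0l => /esym/eqP; rewrite oner_eq0.
    have w0 : w = 0 by rewrite -[w]mul1mx -ZY2 -mulmxA -/u u0 mulmx0.
    by rewrite -[e]mul1mx -GK -mulmxA -/w w0 mulmx0.
  have u2 : 0 < fro u ^+ 2 by rewrite exprn_gt0 // lt_def u0 fro_ge0.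
  by rewrite -(ler_pM2r u2) mul1r.
have H1 (v : 'cV[C]_n) : dot v (H *m v) <= dot v v.
  rewrite {1}HE dot_udiag (dot_weight v Wu) ler_sum // => i _.
  by rewrite -[leRHS]mul1r ler_wpM2r ?weight_ge0.
(* Congruence by G turns H <= I into X1 X2 <= G G = Y1 Y2. *)
move=> v; have := H1 (G *m v).
have -> : H *m (G *m v) = K *m (X1 *m X2 *m v).
  by rewrite /H -!mulmxA (mulmxA K G) KG mul1mx.
by rewrite !dot_mull Gh !mulmxA GK GG mul1mx.
Qed.

Lemma udiag_commute n (U : 'M[C]_n) d e : U \is unitarymx ->
  udiag U d *m udiag U e = udiag U e *m udiag U d.
Proof.
move=> Uu; rewrite (udiagM d e Uu) (udiagM e d Uu).
by apply: eq_udiag => i; rewrite mulrC.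
Qed.

Lemma udiag_inv n (U : 'M[C]_n) d : U \is unitarymx -> (forall i, d i != 0) ->
  udiag U d *m udiag U (fun i => (d i)^-1) = 1%:M.
Proof.
move=> Uu d0; rewrite udiagM // -(udiag_cst 1 Uu); apply: eq_udiag => i.
by rewrite mulfV.
Qed.

Lemma dot_udiag_sq n (U : 'M[C]_n) d (v : 'cV[C]_n) : U \is unitarymx ->
  dot v (udiag U (fun i => d i ^+ 2) *m v) = fro (udiag U d *m v) ^+ 2.
Proof.
by move=> Uu; rewrite fro_sq dot_mull udiag_herm mulmxA (udiagM d d Uu).
Qed.

(** Matrices with a common eigenbasis commute, and the order hypotheses on the squares are norm
    inequalities for the matrices themselves. So [midpoint_mx] applies, with G the square root of
    the product on the V side. *)
Lemma midpoint_udiag n (U V : 'M[C]_n) (x1 x2 y1 y2 : 'I_n -> R) :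
  U \is unitarymx -> V \is unitarymx ->
  (forall i, 0 < y1 i) -> (forall i, 0 < y2 i) ->
  (forall v : 'cV[C]_n, dot v (udiag U (fun i => x1 i ^+ 2) *m v)
                     <= dot v (udiag V (fun i => y1 i ^+ 2) *m v)) ->
  (forall v : 'cV[C]_n, dot v (udiag U (fun i => x2 i ^+ 2) *m v)
                     <= dot v (udiag V (fun i => y2 i ^+ 2) *m v)) ->
  forall v : 'cV[C]_n, dot v (udiag U (fun i => x1 i * x2 i) *m v)
                    <= dot v (udiag V (fun i => y1 i * y2 i) *m v).
Proof.
move=> Uu Vu y1p y2p le1 le2 v.
have froE (x y : 'I_n -> R) (w : 'cV[C]_n) : dot w (udiag U (fun i => x i ^+ 2) *m w)
    <= dot w (udiag V (fun i => y i ^+ 2) *m w) ->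
  fro (udiag U x *m w) <= fro (udiag V y *m w).
  rewrite (dot_udiag_sq x w Uu) (dot_udiag_sq y w Vu).
  by rewrite ler_sqr // nnegrE fro_ge0.
pose g i := Num.sqrt (y1 i * y2 i).
have gp i : g i != 0 by rewrite gt_eqF // sqrtr_gt0 mulr_gt0.
rewrite -(udiagM x1 x2 Uu) -(udiagM y1 y2 Vu).
apply: (@midpoint_mx n _ _ _ _ (udiag V (fun i => (y1 i)^-1)) (udiag V (fun i => (y2 i)^-1))
          (udiag V g) (udiag V (fun i => (g i)^-1))); try exact: udiag_herm.
- exact: udiag_commute.
- exact: udiag_inv.
- by apply: udiag_inv => // i; rewrite gt_eqF.
- by rewrite udiag_commute //; apply: udiag_inv => // i; rewrite gt_eqF.
- rewrite (udiagM g g Vu) (udiagM y1 y2 Vu); apply: eq_udiag => i.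
  by rewrite -expr2 sqr_sqrtr // ltW // mulr_gt0.
- by move=> w; exact: (froE _ _ w (le1 w)).
- by move=> w; exact: (froE _ _ w (le2 w)).
Qed.

(** * Functional calculus and order bounds *)

Definition fcalc n (f : R -> R) (Y : 'M[C]_n) : 'M[C]_n :=
  udiag (spectralmx Y) (fun i => f (ev Y i)).

(** The form bound is tested on the i-th unit eigenvector. *)
Lemma ev_ge n (Y : 'M[C]_n) (c : R) : Y^t* = Y ->
  (forall v : 'cV[C]_n, c * dot v v <= dot v (Y *m v)) -> forall i, c <= ev Y i.
Proof.
move=> Yh cY i; have Wu := spectral_unitarymx Y.
have := cY (col i ((spectralmx Y)^t*)).
have eY : Y *m col i ((spectralmx Y)^t*) = (ev Y i)%:C *: col i ((spectralmx Y)^t*).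
  by rewrite {1}(spectral_udiag Yh) (udiag_eigenvector _ i Wu).
by rewrite eY dotZr (dot_unitary_col i Wu) !mulr1.
Qed.

Lemma fcalc_ge n f (Y : 'M[C]_n) (c : R) (v : 'cV[C]_n) :
  (forall i, c <= f (ev Y i)) -> c * dot v v <= dot v (fcalc f Y *m v).
Proof.
move=> cf; rewrite dot_udiag (dot_weight v (spectral_unitarymx Y)) big_distrr.
by apply: ler_sum => i _; rewrite ler_wpM2r ?weight_ge0.
Qed.

Lemma fcalc_le n f (Y : 'M[C]_n) (c : R) (v : 'cV[C]_n) :
  (forall i, f (ev Y i) <= c) -> dot v (fcalc f Y *m v) <= c * dot v v.
Proof.
move=> cf; rewrite dot_udiag (dot_weight v (spectral_unitarymx Y)) big_distrr.
by apply: ler_sum => i _; rewrite ler_wpM2r ?weight_ge0.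
Qed.

Lemma fro_fcalc_lipschitz n f (Y Z : 'M[C]_n) (K : R) :
  Y^t* = Y -> Z^t* = Z -> 0 <= K ->
  (forall i j, `|f (ev Y i) - f (ev Z j)| <= K * `|ev Y i - ev Z j|) ->
  fro (fcalc f Y - fcalc f Z) <= K * fro (Y - Z).
Proof.
move=> Yh Zh K0 fK.
have := fro_udiag_lipschitz (spectral_unitarymx Y) (spectral_unitarymx Z) K0 fK.
by rewrite -(spectral_udiag Yh) -(spectral_udiag Zh).
Qed.

Lemma sandwich_herm n (A M : 'M[C]_n) : M^t* = M -> (A^t* *m M *m A)^t* = A^t* *m M *m A.
Proof. by move=> Mh; rewrite !adjmxM trmxCK Mh mulmxA. Qed.

Lemma sandwichB n (A M N : 'M[C]_n) :
  A^t* *m (M - N) *m A = A^t* *m M *m A - A^t* *m N *m A.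
Proof. by rewrite mulmxBr mulmxBl. Qed.

Lemma dot_sandwich n (A M : 'M[C]_n) (v : 'cV[C]_n) :
  dot v (A^t* *m M *m A *m v) = dot (A *m v) (M *m (A *m v)).
Proof. by rewrite dot_mull !mulmxA. Qed.

(** The form at v is the inner product of M with v v^*, so it is continuous in M for the Frobenius
    norm; order relations pass to limits this way. *)
Lemma dot_quad_le n (M : 'M[C]_n) (v : 'cV[C]_n) :
  dot v (M *m v) <= fro M * fro (v *m v^t*).
Proof. by rewrite dotC dot_mulr; exact: dot_le_fro. Qed.

Lemma Re_le_fro m n (M : 'M[C]_(m, n)) i j : `|Re (M i j)| <= fro M.
Proof.
rewrite -ler_sqr ?nnegrE ?fro_ge0 // real_normK ?num_real // fro_sq.
by apply: le_trans (entry_sq_le_dot M i j); rewrite lerDl sqr_ge0.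
Qed.

Lemma Im_le_fro m n (M : 'M[C]_(m, n)) i j : `|Im (M i j)| <= fro M.
Proof.
rewrite -ler_sqr ?nnegrE ?fro_ge0 // real_normK ?num_real // fro_sq.
by apply: le_trans (entry_sq_le_dot M i j); rewrite lerDr sqr_ge0.
Qed.

(** The norm of the matrix with all entries 1 + i is the dimension constant, which never has to be
    computed. *)
Lemma fro_le_entries m n (M : 'M[C]_(m, n)) (c : R) : 0 <= c ->
  (forall i j, `|Re (M i j)| <= c /\ `|Im (M i j)| <= c) ->
  fro M <= c * fro (const_mx (1 +i* 1) : 'M[C]_(m, n)).
Proof.
move=> c0 Mc; apply: fro_le => //; rewrite /dot big_distrr ler_sum //= => i _.
rewrite big_distrr ler_sum //= => j _; rewrite !mxE /= -!expr2.
have [] := Mc i j; rewrite -!(ler_sqr (y := c)) ?nnegrE // !real_normK ?num_real //.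
by move=> *; lra.
Qed.

Lemma fro_sub_sym m n (M N : 'M[C]_(m, n)) : fro (M - N) = fro (N - M).
Proof. by rewrite /fro -opprB dotNl dotNr opprK. Qed.

Lemma fro_le0 m n (M : 'M[C]_(m, n)) : fro M <= 0 -> M = 0.
Proof. by move=> M0; apply: fro_eq0; apply: le_anti; rewrite M0 fro_ge0. Qed.

End LinearAlgebra.

(** * Loewner-Heinz inequality and fixed point *)

Section RealMatrices.
Import Order.TTheory GRing.Theory Num.Theory.
Local Open Scope ring_scope.
Local Open Scope sesquilinear_scope.
Local Open Scope complex_scope.

Local Notation R := Rdefinitions.R.
Local Notation C := R[i].
Local Notation Re := (@complex.Re R).
Local Notation Im := (@complex.Im R).

Lemma loewner_heinz n (U V : 'M[C]_n) (d e : 'I_n -> R) (th : R) :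
  U \is unitarymx -> V \is unitarymx ->
  (forall i, 0 < d i) -> (forall i, 0 < e i) -> 0 <= th <= 1 ->
  (forall v : 'cV[C]_n, dot v (udiag U d *m v) <= dot v (udiag V e *m v)) ->
  forall v : 'cV[C]_n, dot v (udiag U (fun i => Rpower (d i) th) *m v)
                    <= dot v (udiag V (fun i => Rpower (e i) th) *m v).
Proof.
move=> Uu Vu dp ep /andP[/RleP th0 /RleP th1] le v.
(* J asks for all vectors, because the midpoint step uses the whole order relation; phi fixes v, so
   that continuity concerns a scalar function. *)
pose J (a : R) := forall w : 'cV[C]_n, dot w (udiag U (fun i => Rpower (d i) a) *m w)
                    <= dot w (udiag V (fun i => Rpower (e i) a) *m w).
pose phi a := \sum_i Rpower (e i) a * weight V v i - \sum_i Rpower (d i) a * weight U v i.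
have J0 : J 0.
  move=> w; rewrite (eq_udiag (e := fun=> 1) U) ?(eq_udiag (e := fun=> 1) V).
  - by rewrite (udiag_cst 1 Uu) (udiag_cst 1 Vu).
  - by move=> i; apply: Rpower_O; apply/RltP.
  - by move=> i; apply: Rpower_O; apply/RltP.
have J1 : J 1.
  move=> w; rewrite (eq_udiag (e := d) U) ?(eq_udiag (e := e) V) //.
  - by move=> i; apply: Rpower_1; apply/RltP.
  - by move=> i; apply: Rpower_1; apply/RltP.
(* The midpoint inequality is applied to the half powers d^(a/2), d^(b/2) and e^(a/2), e^(b/2):
   their squares are the powers in J a and J b, their products the powers at (a + b) / 2. *)
have Jmid a b : J a -> J b -> J (Rdiv (Rplus a b) (IZR 2)).
  move=> Ja Jb.
  have sqE (f : 'I_n -> R) (x : R) i : Rpower (f i) (x / 2) ^+ 2 = Rpower (f i) x.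
    by rewrite expr2 -[LHS]Rpower_plus RplusE -splitr.
  have mulE (f : 'I_n -> R) i : Rpower (f i) (a / 2) * Rpower (f i) (b / 2)
      = Rpower (f i) (Rdiv (Rplus a b) (IZR 2)).
    by rewrite -[LHS]Rpower_plus RplusE -mulrDl.
  move=> w; rewrite -(eq_udiag U (mulE d)) -(eq_udiag V (mulE e)).
  apply: (midpoint_udiag Uu Vu) => [i|i|x|x].
  - by apply/RltP; exact: Rpower_pos.
  - by apply/RltP; exact: Rpower_pos.
  - rewrite (eq_udiag U (sqE d a)) (eq_udiag V (sqE e a)); exact: Ja.
  - rewrite (eq_udiag U (sqE d b)) (eq_udiag V (sqE e b)); exact: Jb.
have cont (f g : 'I_n -> R) : continuity (fun a => \sum_i Rpower (f i) a * g i).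
  apply: continuity_sum => i _.
  apply: (continuity_mult (fun a => Rpower (f i) a) (fun=> g i)); last exact: continuity_const.
  apply: (continuity_comp (fun a => Rmult a (ln (f i))) exp).
    by apply: continuity_mult; [exact: derivable_continuous derivable_id|exact: continuity_const].
  exact: derivable_continuous derivable_exp.
have phic : continuity phi by apply: continuity_minus; exact: cont.
have phiE a : phi a = dot v (udiag V (fun i => Rpower (e i) a) *m v)
                    - dot v (udiag U (fun i => Rpower (d i) a) *m v).
  by rewrite (dot_udiag V) (dot_udiag U).
have Jphi a : J a -> Rle 0 (phi a).
  by move=> Ja; apply/RleP; rewrite phiE subr_ge0; exact: Ja.
have := @midpoint_closed_nonneg J phi th J0 J1 Jmid phic Jphi (conj th0 th1).
by rewrite phiE => /RleP; rewrite subr_ge0.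
Qed.

(** * Geometric convergence and Banach's fixed point theorem *)

Lemma geometric_cv (u : nat -> R) (c L : R) : 0 <= L < 1 ->
  (forall m, `|u m.+1 - u m| <= c * L ^+ m) ->
  exists l, forall m, `|u m - l| <= c / (1 - L) * L ^+ m.
Proof.
move=> /andP[/RleP L0 /RltP L1] uc.
have [m|l ul] := @geometric_increments_cv u c L (conj L0 L1).
  by have /RleP := uc m; rewrite -RpowE -RabsE.
by exists l => m; apply/RleP; rewrite -RpowE -RabsE; exact: ul.
Qed.

Lemma geometric_small (x c L : R) : 0 <= L < 1 ->
  (forall m, x <= c * L ^+ m) -> x <= 0.
Proof.
move=> /andP[/RleP L0 /RltP L1] xc; apply/RleP.
apply: (@geometric_le_0 x c L (conj L0 L1)) => m.
by have /RleP := xc m; rewrite -RpowE.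
Qed.

Arguments geometric_small : clear scopes.

(** Each entry is within the Frobenius norm, so real and imaginary parts converge separately; finite
    choice assembles their limits into a matrix. *)
Lemma fro_geometric_cv m n (u : nat -> 'M[C]_(m, n)) (c L : R) : 0 <= L < 1 ->
  (forall k, fro (u k.+1 - u k) <= c * L ^+ k) ->
  exists Y c', forall k, fro (u k - Y) <= c' * L ^+ k.
Proof.
move=> L01 uc.
have entry i j : exists l : C, forall k,
    `|Re (u k i j - l)| <= c / (1 - L) * L ^+ k /\
    `|Im (u k i j - l)| <= c / (1 - L) * L ^+ k.
  have [k|a ua] := @geometric_cv (fun k => Re (u k i j)) c L L01.
    apply: le_trans (uc k); apply: le_trans (Re_le_fro _ i j).
    by rewrite !mxE; case: (u k.+1 i j) (u k i j) => [? ?] [? ?].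
  have [k|b ub] := @geometric_cv (fun k => Im (u k i j)) c L L01.
    apply: le_trans (uc k); apply: le_trans (Im_le_fro _ i j).
    by rewrite !mxE; case: (u k.+1 i j) (u k i j) => [? ?] [? ?].
  exists (a +i* b) => k; have := ub k; have := ua k.
  by case: (u k i j) => [? ?] /=.
have /fin_all_exists[Y HY] := fun i => fin_all_exists (entry i).
exists (\matrix_(i, j) Y i j), (c / (1 - L) * fro (const_mx (1 +i* 1) : 'M[C]_(m, n))) => k.
rewrite mulrAC; apply: fro_le_entries => [|i j].
  have c0 : 0 <= c by have := uc 0; rewrite expr0 mulr1; apply: le_trans; exact: fro_ge0.
  have /andP[L0 L1] := L01.
  by rewrite mulr_ge0 ?exprn_ge0 // divr_ge0 // subr_ge0 ltW.
by rewrite !mxE; exact: HY.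
Qed.

(** Closedness of D is asked only along sequences converging at the rate L^k, which is the rate of
    the iterates. *)
Lemma banach_fro m n (D : 'M[C]_(m, n) -> Prop) (F : 'M[C]_(m, n) -> 'M[C]_(m, n))
    (L : R) (Y0 : 'M[C]_(m, n)) :
  0 <= L < 1 -> D Y0 -> (forall Y, D Y -> D (F Y)) ->
  (forall Y Z, D Y -> D Z -> fro (F Y - F Z) <= L * fro (Y - Z)) ->
  (forall u Y c, (forall k, D (u k)) -> (forall k, fro (u k - Y) <= c * L ^+ k) -> D Y) ->
  exists Y, D Y /\ F Y = Y.
Proof.
move=> L01 D0 DF FL Dcl; have /andP[L0 L1] := L01.
pose u k := iter k F Y0.
have Du k : D (u k) by elim: k => [//|k IH]; exact: DF.
have step k : fro (u k.+1 - u k) <= fro (u 1 - u 0) * L ^+ k.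
  elim: k => [|k IH]; first by rewrite expr0 mulr1.
  apply: le_trans (FL _ _ (Du k.+1) (Du k)) _.
  by rewrite exprS mulrCA; apply: ler_wpM2l.
have [Y [c uY]] := fro_geometric_cv L01 step.
have DY : D Y by apply: Dcl uY.
exists Y; split=> //; apply/eqP; rewrite -subr_eq0; apply/eqP; apply: fro_le0.
(* F Y - Y is split at u (k + 1) = F (u k); each half is at most c L^k. *)
apply: (@geometric_small _ (2 * c) L L01) => k.
have -> : F Y - Y = (F Y - F (u k)) + (u k.+1 - Y) by rewrite addrA subrK.
apply: le_trans (froD _ _) _.
have lec : L * (c * L ^+ k) <= c * L ^+ k.
  rewrite -[leRHS]mul1r; apply: ler_wpM2r; last exact: ltW.
  by apply: le_trans (uY k); exact: fro_ge0.
have h1 : fro (F Y - F (u k)) <= c * L ^+ k.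
  apply: le_trans (FL _ _ DY (Du k)) _; apply: le_trans lec.
  by apply: ler_wpM2l => //; rewrite fro_sub_sym.
have h2 : fro (u k.+1 - Y) <= c * L ^+ k.
  by apply: le_trans (uY k.+1) _; rewrite exprS mulrCA.
by rewrite -mulrA mulr_natl mulr2n; exact: lerD.
Qed.

(** Of the scalar functions f and g only their bounds and Lipschitz constants on [c, oo) enter.
    Banach's theorem is applied on the order interval [c I, Q], with contraction constant a^2 Kf +
    b^2 Kg. *)
Lemma fixed_point n (A B Q : 'M[C]_n) (a b kt c : R) (f g : R -> R) (Kf Kg fc gc : R) :
  Q^t* = Q -> 0 <= a -> 0 <= b -> opbound A a -> opbound B b ->
  (forall v : 'cV[C]_n, kt * dot v v <= dot v (Q *m v)) ->
  0 <= Kf -> 0 <= Kg ->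
  (forall x, c <= x -> 0 <= f x <= fc) -> (forall x, c <= x -> 0 <= g x <= gc) ->
  (forall x y, c <= x -> c <= y -> `|f x - f y| <= Kf * `|x - y|) ->
  (forall x y, c <= x -> c <= y -> `|g x - g y| <= Kg * `|x - y|) ->
  a ^+ 2 * fc + b ^+ 2 * gc <= kt - c ->
  a ^+ 2 * Kf + b ^+ 2 * Kg < 1 ->
  exists Y : 'M[C]_n, [/\ Y^t* = Y,
    forall v : 'cV[C]_n, c * dot v v <= dot v (Y *m v),
    forall v : 'cV[C]_n, dot v (Y *m v) <= dot v (Q *m v) &
    Y + (A^t* *m fcalc f Y *m A + B^t* *m fcalc g Y *m B) = Q].
Proof.
move=> Qh a0 b0 Aa Bb Qk Kf0 Kg0 f01 g01 fL gL inv con.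
pose D (Y : 'M[C]_n) := [/\ Y^t* = Y,
    forall v : 'cV[C]_n, c * dot v v <= dot v (Y *m v) &
    forall v : 'cV[C]_n, dot v (Y *m v) <= dot v (Q *m v)].
pose F (Y : 'M[C]_n) := Q - (A^t* *m fcalc f Y *m A + B^t* *m fcalc g Y *m B).
have evD Y : D Y -> forall i, c <= ev Y i by case=> Yh Yc _; exact: ev_ge.
have sand (h : R -> R) (hc : R) (M Y : 'M[C]_n) (x : R) (v : 'cV[C]_n) :
    opbound M x -> (forall y, c <= y -> 0 <= h y <= hc) -> D Y ->
    0 <= dot v (M^t* *m fcalc h Y *m M *m v) <= x ^+ 2 * hc * dot v v.
  move=> Mx h01 DY; rewrite dot_sandwich.
  have hb i : 0 <= h (ev Y i) <= hc by apply: h01; exact: evD.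
  apply/andP; split.
    have := @fcalc_ge _ _ h Y 0 (M *m v); rewrite mul0r; apply => i.
    by case/andP: (hb i).
  have hc0 : 0 <= hc by case/andP: (h01 _ (lexx c)); exact: le_trans.
  apply: (@le_trans _ _ (hc * dot (M *m v) (M *m v))).
    by apply: fcalc_le => i; case/andP: (hb i).
  rewrite [x ^+ 2 * _]mulrC -mulrA; apply: ler_wpM2l => //; exact: Mx.
have sandh (h : R -> R) (M Y : 'M[C]_n) :
    (M^t* *m fcalc h Y *m M)^t* = M^t* *m fcalc h Y *m M.
  by apply: sandwich_herm; exact: udiag_herm.
have fc0 : 0 <= fc by case/andP: (f01 _ (lexx c)); exact: le_trans.
have gc0 : 0 <= gc by case/andP: (g01 _ (lexx c)); exact: le_trans.
have a2 : 0 <= a ^+ 2 by exact: sqr_ge0.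
have b2 : 0 <= b ^+ 2 by exact: sqr_ge0.
(* This puts Q in the interval, where the iteration starts. *)
have ckt : c <= kt.
  by rewrite -subr_ge0; apply: le_trans inv; rewrite addr_ge0 // mulr_ge0.
have L01 : 0 <= a ^+ 2 * Kf + b ^+ 2 * Kg < 1 by rewrite con addr_ge0 // mulr_ge0.
have DQ : D Q.
  by split=> // v; apply: le_trans (Qk v); apply: ler_wpM2r => //; exact: dot_ge0.
(* The subtracted terms are positive semidefinite, which gives F Y <= Q, and together they are at
   most (kt - c) I, which gives c I <= F Y. *)
have DF Y : D Y -> D (F Y).
  move=> DY; have dF v : dot v (F Y *m v) = dot v (Q *m v) -
      (dot v (A^t* *m fcalc f Y *m A *m v) + dot v (B^t* *m fcalc g Y *m B *m v)).
    by rewrite /F mulmxBl mulmxDl dotDr dotNr dotDr.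
  split=> [|v|v].
  - by rewrite /F adjmxD adjmxN adjmxD Qh !sandh.
  - have /andP[_ sA] := sand f fc A Y a v Aa f01 DY.
    have /andP[_ sB] := sand g gc B Y b v Bb g01 DY.
    rewrite dF lerBrDr -lerBrDl.
    apply: le_trans (lerD sA sB) _; rewrite -mulrDl.
    apply: (@le_trans _ _ ((kt - c) * dot v v)).
      by apply: ler_wpM2r => //; exact: dot_ge0.
    by rewrite mulrBl; apply: lerB.
  - have /andP[sA _] := sand f fc A Y a v Aa f01 DY.
    have /andP[sB _] := sand g gc B Y b v Bb g01 DY.
    rewrite dF gerBl; exact: addr_ge0 sA sB.
have sub4 (P u v w x : 'M[C]_n) : (P - (v + x)) - (P - (u + w)) = (u - v) + (w - x).
  by rewrite opprB addrC addrA subrK opprD addrACA.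
have FL Y Z : D Y -> D Z -> fro (F Y - F Z) <= (a ^+ 2 * Kf + b ^+ 2 * Kg) * fro (Y - Z).
  move=> DY DZ; rewrite fro_sub_sym.
  have -> : F Z - F Y = A^t* *m (fcalc f Y - fcalc f Z) *m A +
                        B^t* *m (fcalc g Y - fcalc g Z) *m B.
    exact: etrans (sub4 Q _ _ _ _) (esym (congr2 +%R (sandwichB A _ _) (sandwichB B _ _))).
  have [[Yh _ _] [Zh _ _]] := (DY, DZ).
  apply: le_trans (froD _ _) _; rewrite mulrDl; apply: lerD.
  - apply: le_trans (fro_sandwich _ a0 Aa) _; rewrite -mulrA; apply: ler_wpM2l => //.
    by apply: fro_fcalc_lipschitz => // i j; apply: fL; exact: evD.
  - apply: le_trans (fro_sandwich _ b0 Bb) _; rewrite -mulrA; apply: ler_wpM2l => //.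
    by apply: fro_fcalc_lipschitz => // i j; apply: gL; exact: evD.
(* For each of the three conditions, the failure at the limit Y is bounded by a multiple of |u m -
   Y|, hence by a geometric sequence. *)
have Dcl u Y (k : R) : (forall m, D (u m)) ->
    (forall m, fro (u m - Y) <= k * (a ^+ 2 * Kf + b ^+ 2 * Kg) ^+ m) -> D Y.
  move=> Du uY; split=> [|v|v].
  - apply/eqP; rewrite -subr_eq0; apply/eqP; apply: fro_le0.
    apply: (@geometric_small _ (2 * k) _ L01) => m; have [uh _ _] := Du m.
    have -> : Y^t* - Y = (u m - Y) - (u m - Y)^t*.
      by rewrite adjmxD adjmxN uh opprB [RHS]addrC addrA subrK.
    apply: le_trans (froD _ _) _; rewrite -mulrA mulr_natl mulr2n; apply: lerD => //.
    by rewrite -adjmxN fro_adj opprB fro_sub_sym.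
  - rewrite -subr_le0; apply: (@geometric_small _ (k * fro (v *m v^t*)) _ L01) => m.
    have [_ uc _] := Du m; rewrite mulrAC.
    apply: le_trans (_ : dot v ((u m - Y) *m v) <= _).
      by rewrite mulmxBl dotDr dotNr; apply: lerB.
    apply: le_trans (dot_quad_le _ _) _; apply: ler_wpM2r => //; exact: fro_ge0.
  - rewrite -subr_le0; apply: (@geometric_small _ (k * fro (v *m v^t*)) _ L01) => m.
    have [_ _ uQ] := Du m; rewrite mulrAC.
    apply: le_trans (_ : dot v ((Y - u m) *m v) <= _).
      by rewrite mulmxBl dotDr dotNr; apply: lerB.
    apply: le_trans (dot_quad_le _ _) _; apply: ler_wpM2r; first exact: fro_ge0.
    by rewrite fro_sub_sym.
have [Y [[Yh Yc YQ] FY]] := banach_fro L01 DQ DF FL Dcl.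
by exists Y; split=> //; rewrite -{1}FY /F subrK.
Qed.

(** * Translation to index-function matrices *)

Definition cplx (z : Defs.C) : C := z.1 +i* z.2.
Definition mx n (A : Mat) : 'M[C]_n := \matrix_(i, j) cplx (A i j).
Definition cv n (v : Vec) : 'cV[C]_n := \col_i cplx (v i).

(** Outside the n by n block the entries default to [C0]; [meq n] compares only indices below n. *)
Definition unmx n (M : 'M[C]_n) : Mat := fun i j =>
  if (insub i, insub j) is (Some i', Some j')
  then (complex.Re (M i' j'), complex.Im (M i' j')) else C0.
Definition uncv n (v : 'cV[C]_n) : Vec := fun i =>
  if insub i is Some i' then (complex.Re (v i' 0), complex.Im (v i' 0)) else C0.
Definition unfam n (d : 'I_n -> R) : nat -> R := fun i =>
  if insub i is Some i' then d i' else 0.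

Lemma cplx_inj : injective cplx.
Proof. by move=> [a b] [c d] [-> ->]. Qed.

Lemma cplx_sum n (f : nat -> Defs.C) : cplx (Csum n f) = \sum_(k < n) cplx (f k).
Proof.
elim: n => [|n IH]; first by rewrite big_ord0.
by rewrite big_ord_recr /= -IH; case: (Csum n f) (f n) => a b [c d].
Qed.

Lemma cplx_mul (z w : Defs.C) : cplx (Cmul z w) = cplx z * cplx w.
Proof. by case: z w => a b [c d]. Qed.

Lemma Rsum_bigop n (f : nat -> R) : Rsum n f = \sum_(k < n) f k.
Proof. by elim: n => [|n IH] /=; rewrite ?big_ord0 // big_ord_recr /= -IH. Qed.

Lemma mx_meq n (A B : Mat) : meq n A B <-> mx n A = mx n B.
Proof.
split=> [AB | /matrixP AB i j /ssrnat.ltP i_n /ssrnat.ltP j_n].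
  by apply/matrixP => i j; rewrite !mxE AB //; apply/ssrnat.ltP.
by apply: cplx_inj; have := AB (Ordinal i_n) (Ordinal j_n); rewrite !mxE.
Qed.

Lemma mx_unmx n (M : 'M[C]_n) : mx n (unmx M) = M.
Proof.
apply/matrixP => i j; rewrite mxE /unmx !valK /cplx /=.
by case: (M i j).
Qed.

Lemma cv_uncv n (v : 'cV[C]_n) : cv n (uncv v) = v.
Proof. by apply/colP => i; rewrite mxE /uncv valK /cplx /=; case: (v i 0). Qed.

Lemma mx_mul n (A B : Mat) : mx n (mmul n A B) = mx n A *m mx n B.
Proof.
apply/matrixP => i j; rewrite !mxE cplx_sum; apply: eq_bigr => k _.
by rewrite cplx_mul !mxE.
Qed.

Lemma mx_adj n (A : Mat) : mx n (madj A) = (mx n A)^t*.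
Proof. by apply/matrixP => i j; rewrite !mxE. Qed.

Lemma mx_add n (A B : Mat) : mx n (madd A B) = mx n A + mx n B.
Proof. by apply/matrixP => i j; rewrite !mxE. Qed.

Lemma mx_sub n (A B : Mat) : mx n (msub A B) = mx n A - mx n B.
Proof. by apply/matrixP => i j; rewrite !mxE. Qed.

Lemma mx_Id n : mx n Id = 1%:M.
Proof.
apply/matrixP => i j; rewrite !mxE /Id -val_eqE /=.
by case: eqVneq => [->|ij]; [rewrite Nat.eqb_refl|case: Nat.eqb_spec ij => // ->; rewrite eqxx].
Qed.

Lemma mx_scal n (c : R) (A : Mat) : mx n (mscal c A) = c%:C *: mx n A.
Proof. by apply/matrixP => i j; rewrite !mxE cplx_mul. Qed.

Lemma mx_diag n (d : nat -> R) : mx n (diag d) = diag_mx (\row_i (d i)%:C).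
Proof.
apply/matrixP => i j; rewrite !mxE /diag -val_eqE /=.
by case: eqVneq => [->|ij]; [rewrite Nat.eqb_refl|case: Nat.eqb_spec ij => // ->; rewrite eqxx].
Qed.

Lemma cv_mvmul n (A : Mat) (v : Vec) : cv n (mvmul n A v) = mx n A *m cv n v.
Proof.
apply/colP => i; rewrite !mxE cplx_sum; apply: eq_bigr => k _.
by rewrite cplx_mul !mxE.
Qed.

Lemma Cre_quad n (A : Mat) (v : Vec) : Cre (quad n A v) = dot (cv n v) (mx n A *m cv n v).
Proof.
rewrite -cv_mvmul /dot.
have -> : Cre (quad n A v) = complex.Re (cplx (quad n A v)) by [].
rewrite /quad cplx_sum Re_sum; apply: eq_bigr => i _.
rewrite big_ord1 !mxE /=; case: (v i) (mvmul n A v i) => a b [c d] /=.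
by rewrite RminusE !RmultE RoppE mulNr opprK.
Qed.

Lemma vnorm_fro n (v : Vec) : vnorm n v = fro (cv n v).
Proof.
rewrite /vnorm /fro RsqrtE Rsum_bigop; congr Num.sqrt; apply: eq_bigr => i _.
by rewrite big_ord1 !mxE.
Qed.

Lemma hermitian_mx n (A : Mat) : Defs.hermitian n A <-> (mx n A)^t* = mx n A.
Proof. by rewrite -mx_adj; split=> [/mx_meq|/esym/mx_meq]. Qed.

Lemma dot_vnonzero n (v : Vec) : vnonzero n v <-> 0 < dot (cv n v) (cv n v).
Proof.
split=> [[i [/ssrnat.ltP i_n vi]]|v0].
  rewrite lt_def dot_ge0 andbT; apply: contra_notN vi => /eqP/dot_eq0/colP/(_ (Ordinal i_n)).
  by rewrite !mxE => h; apply: cplx_inj.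
have [i vi | all0] := pickP (fun i : 'I_n => cv n v i 0 != 0).
  by exists i; split; [apply/ssrnat.ltP | move=> vi0; move: vi; rewrite mxE vi0 eqxx].
move: v0; have -> : cv n v = 0.
  by apply/colP => i; rewrite [RHS]mxE; apply/eqP; have := all0 i; case: eqP.
by rewrite dot0l ltxx.
Qed.

Lemma mle_mx n (P S : Mat) : (mx n P)^t* = mx n P -> (mx n S)^t* = mx n S ->
  (forall v : 'cV[C]_n, dot v (mx n P *m v) <= dot v (mx n S *m v)) -> mle n P S.
Proof.
move=> Ph Sh PS; split; first exact/hermitian_mx.
split; first exact/hermitian_mx.
split; first by apply/hermitian_mx; rewrite mx_sub adjmxD adjmxN Ph Sh.
move=> v; apply/RleP; rewrite Cre_quad mx_sub mulmxBl dotDr dotNr subr_ge0; exact: PS.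
Qed.

(** [udiag] has the form U^* D U and [is_rpow] the form U D U^*, so the unitary witness is the
    adjoint of U. *)
Lemma is_rpow_udiag n (X Y : Mat) (U : 'M[C]_n) (d : 'I_n -> R) (r : R) :
  U \is unitarymx -> (forall i, 0 < d i) -> mx n X = udiag U d ->
  mx n Y = udiag U (fun i => Rpower (d i) r) -> is_rpow n X r Y.
Proof.
move=> Uu dp XE YE; exists (unmx (U^t*)), (unfam d); split; [|split; [|split]].
- split; apply/mx_meq; rewrite mx_mul mx_adj mx_unmx mx_Id trmxCK.
    exact/unitarymxP.
  exact: unitarymx_mulVmx.
- by move=> i /ssrnat.ltP i_n; rewrite /unfam insubT; apply/RltP.
- apply/mx_meq; rewrite !mx_mul mx_adj mx_unmx trmxCK mx_diag XE.
  by apply: (congr1 (fun r => U^t* *m diag_mx r *m U)); apply/rowP => i; rewrite !mxE /unfam valK.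
- apply/mx_meq; rewrite !mx_mul mx_adj mx_unmx trmxCK mx_diag YE.
  by apply: (congr1 (fun r => U^t* *m diag_mx r *m U)); apply/rowP => i; rewrite !mxE /unfam valK.
Qed.

(** * Operator norms and eigenvalues across the two encodings *)

Lemma opnorm_opbound n (A : Mat) (a : R) : is_opnorm n A a -> 0 <= a /\ opbound (mx n A) a.
Proof.
move=> [/RleP a0 [Aa _]]; split=> // v.
have /RleP := Aa (uncv v); rewrite !vnorm_fro cv_mvmul cv_uncv => le.
by rewrite -!fro_sq -exprMn ler_sqr ?nnegrE ?mulr_ge0 ?fro_ge0.
Qed.

(** Through this the extremality in [is_lambda_min] bounds every spectral value [ev]. *)
Lemma eigval_ev n (A : Mat) i : (mx n A)^t* = mx n A -> is_eigval n A (ev (mx n A) i).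
Proof.
move=> Ah; have Wu := spectral_unitarymx (mx n A).
set w := col i ((spectralmx (mx n A))^t*).
have eA : mx n A *m w = (ev (mx n A) i)%:C *: w.
  by rewrite {1}(spectral_udiag Ah) (udiag_eigenvector _ i Wu).
exists (uncv w); split.
  by apply/dot_vnonzero; rewrite cv_uncv (dot_unitary_col i Wu).
move=> j /ssrnat.ltP j_n; apply: cplx_inj.
move/colP: eA => /(_ (Ordinal j_n)); rewrite -{1}[w]cv_uncv -cv_mvmul mxE /= => ->.
by rewrite cplx_mul mxE -{1}[w]cv_uncv mxE.
Qed.

Lemma posdef_eigval n (A : Mat) (l : R) : posdef n A -> is_eigval n A l -> 0 < l.
Proof.
move=> [_ Apos] [v [v0 Av]]; have /RltP := Apos v v0; rewrite Cre_quad.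
have -> : mx n A *m cv n v = l%:C *: cv n v.
  rewrite -cv_mvmul; apply/colP => i; rewrite !mxE Av; last exact/ssrnat.ltP.
  by rewrite cplx_mul.
by move/dot_vnonzero in v0; rewrite dotZr pmulr_lgt0.
Qed.

Lemma lambda_min_dot n (A : Mat) (k : R) : (mx n A)^t* = mx n A -> is_lambda_min n A k ->
  forall v : 'cV[C]_n, k * dot v v <= dot v (mx n A *m v).
Proof.
move=> Ah [_ kmin] v; rewrite {1}(spectral_udiag Ah).
apply: (@fcalc_ge _ _ id) => i; apply/RleP; apply: kmin; exact: eigval_ev.
Qed.

(** The fixed point is sought above m I; the possibly smaller c serves only for the lower bound
    claimed for X. *)
Lemma power_equation_solution n (s t p : R) (A B Q : Mat) (kt a b m c : R) :
  1 <= s -> 0 < t -> 0 < p -> posdef n Q -> is_lambda_min n Q kt ->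
  is_opnorm n A a -> is_opnorm n B b -> 0 < c <= m ->
  a ^+ 2 * Rpower m (- (t / s)) + b ^+ 2 * Rpower m (- (p / s)) <= kt - m ->
  a ^+ 2 * Rmult (t / s) (Rpower m (- (t / s) - 1)) +
  b ^+ 2 * Rmult (p / s) (Rpower m (- (p / s) - 1)) < 1 ->
  exists X : Mat,
    posdef n X /\
    (exists Xs Xt Xp : Mat,
        is_rpow n X s Xs /\ is_rpow n X (- t) Xt /\ is_rpow n X (- p) Xp /\
        meq n (madd Xs (madd (mmul n (mmul n (madj A) Xt) A)
                             (mmul n (mmul n (madj B) Xp) B))) Q) /\
    mle n (mscal (Rpower c (1 / s)) Id) X /\
    (exists Qs : Mat, is_rpow n Q (1 / s) Qs /\ mle n X Qs).
Proof.
move=> s1 t0 p0 [/hermitian_mx Qh Qpos] Qmin /opnorm_opbound[a0 Aa] /opnorm_opbound[b0 Bb].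
move=> /andP[c0 cm] inv con.
have m0 : 0 < m by exact: lt_le_trans cm.
have s0 : 0 < s by exact: lt_le_trans s1.
have Qk := lambda_min_dot Qh Qmin.
have bnd (r : R) : 0 < r -> forall x, m <= x -> 0 <= Rpower x (- r) <= Rpower m (- r).
  move=> r0 x mx; apply/andP; split; apply/RleP; first by left; exact: Rpower_pos.
  by apply: Rpower_neg_le; [left; apply/RltP|apply/RltP|apply/RleP].
have lip (r : R) : 0 < r -> forall x y, m <= x -> m <= y ->
    `|Rpower x (- r) - Rpower y (- r)| <= Rmult r (Rpower m (- r - 1)) * `|x - y|.
  move=> r0 x y mx my; apply/RleP; rewrite -!RabsE.
  by apply: Rpower_neg_lipschitz; [apply/RltP|apply/RltP|apply/RleP|apply/RleP].
have K0 (r : R) : 0 < r -> 0 <= Rmult r (Rpower m (- r - 1)).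
  move=> r0; apply: mulr_ge0; first exact: ltW.
  by apply/RleP; left; exact: Rpower_pos.
have ts0 : 0 < t / s by exact: divr_gt0.
have ps0 : 0 < p / s by exact: divr_gt0.
(* Here Y plays X^s, with f(y) = y^(-t/s) and g(y) = y^(-p/s); the order interval is [m I, Q]. *)
have [Y [Yh Ym YQ Yeq]] := fixed_point Qh a0 b0 Aa Bb Qk (K0 _ ts0) (K0 _ ps0)
  (bnd _ ts0) (bnd _ ps0) (lip _ ts0) (lip _ ps0) inv con.
set W := spectralmx Y in Yeq *; have Wu : W \is unitarymx := spectral_unitarymx Y.
have evm i : m <= ev Y i := ev_ge Yh Ym i.
have ev0 i : 0 < ev Y i by exact: lt_le_trans (evm i).
have YE : Y = udiag W (ev Y) := spectral_udiag Yh.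
have Rev0 i : Rlt 0 (ev Y i) by apply/RltP.
have s_neq0 : s <> 0 by move=> s_eq0; move: s0; rewrite s_eq0 ltxx.
(* This is where s >= 1 enters: 1/s is an exponent covered by Loewner-Heinz. *)
have th01 : 0 <= Rdiv 1 s <= 1.
  rewrite RdivE; apply/andP; split; first by apply: divr_ge0 => //; exact: ltW.
  by rewrite ler_pdivrMr // mul1r.
pose x i := Rpower (ev Y i) (1 / s).
have x0 i : 0 < x i by apply/RltP; exact: Rpower_pos.
pose X := udiag W x.
have Xc (v : 'cV[C]_n) : Rpower c (1 / s) * dot v v <= dot v (X *m v).
  apply: (@fcalc_ge _ _ (fun y => Rpower y (1 / s))) => i; apply/RleP.
  apply: Rle_Rpower_l; first by case/andP: th01 => /RleP.
  split; first exact/RltP.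
  by apply/RleP; exact: le_trans (evm i).
have QE := spectral_udiag Qh; have Vu := spectral_unitarymx (mx n Q).
have evQ i : 0 < ev (mx n Q) i.
  apply: lt_le_trans (_ : m <= _) => //.
  apply: (ev_ge Qh) => v; exact: le_trans (YQ v).
exists (unmx X); split; [|split; [|split]].
- split; first by apply/hermitian_mx; rewrite mx_unmx; exact: udiag_herm.
  move=> v /dot_vnonzero v0; apply/RltP; rewrite Cre_quad mx_unmx.
  apply: lt_le_trans (Xc _); apply: mulr_gt0 => //; apply/RltP; exact: Rpower_pos.
(* X is diagonal in the eigenbasis W of Y with eigenvalues y^(1/s), so its powers s, -t and -p are
   Y, Y^(-t/s) and Y^(-p/s), and the equation is the fixed point identity. *)
- exists (unmx Y), (unmx (fcalc (fun y => Rpower y (- (t / s))) Y)),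
    (unmx (fcalc (fun y => Rpower y (- (p / s))) Y)).
  split; [|split; [|split]].
  + apply: (is_rpow_udiag Wu x0 (mx_unmx _)); rewrite mx_unmx {1}YE; apply: eq_udiag => i.
    by rewrite Rpower_root_cancel.
  + apply: (is_rpow_udiag Wu x0 (mx_unmx _)); rewrite mx_unmx; apply: eq_udiag => i.
    by rewrite Rpower_root_neg.
  + apply: (is_rpow_udiag Wu x0 (mx_unmx _)); rewrite mx_unmx; apply: eq_udiag => i.
    by rewrite Rpower_root_neg.
  + apply/mx_meq; rewrite !mx_add !mx_mul !mx_adj !mx_unmx; exact: Yeq.
- apply: mle_mx; rewrite ?mx_unmx ?mx_scal ?mx_Id.
  + by rewrite adjmxZ trmx1 map_mx1.
  + exact: udiag_herm.
  + by move=> v; rewrite -scalemxAl mul1mx dotZr; exact: Xc.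
- exists (unmx (udiag (spectralmx (mx n Q)) (fun i => Rpower (ev (mx n Q) i) (1 / s)))).
  split; first by apply: (is_rpow_udiag Vu evQ); rewrite ?mx_unmx.
  apply: mle_mx; rewrite !mx_unmx; [exact: udiag_herm|exact: udiag_herm|].
  apply: (loewner_heinz Wu Vu ev0 evQ th01) => v.
  by rewrite -YE -QE; exact: YQ.
Qed.

End RealMatrices.


Open Scope R_scope.

Theorem mainTheorem4 (n : nat) (s t p : R) (A B Q : Mat) (k1 kt a b : R) :
  1 <= s -> 1 <= t -> 1 <= p ->
  invertible n A -> invertible n B ->
  posdef n Q ->
  is_lambda_max n Q k1 -> k1 <= 1 ->
  is_lambda_min n Q kt ->
  is_opnorm n A a -> is_opnorm n B b ->
  let q := Rmin (t / s) (p / s) in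
  let qt := Rmax (t / s) (p / s) in
  a ^ 2 + b ^ 2 < Rpower q qt * Rpower kt (qt + 1) / Rpower (q + 1) (qt + 1) ->
  exists X : Mat,
    posdef n X /\
    (exists Xs Xt Xp : Mat,
        is_rpow n X s Xs /\ is_rpow n X (- t) Xt /\ is_rpow n X (- p) Xp /\
        meq n (madd Xs (madd (mmul n (mmul n (madj A) Xt) A)
                             (mmul n (mmul n (madj B) Xp) B))) Q) /\
    mle n (mscal (Rpower (q * kt / (q + 1)) (1 / s)) Id) X /\
    (exists Qs : Mat, is_rpow n Q (1 / s) Qs /\ mle n X Qs).
Proof.
move=> s1 t1 p1 _ _ Qpos [_ k1max] k1le Qmin Aa Bb q qt Hab.
have kt1 : kt <= 1 by apply: Rle_trans k1le; apply: k1max; case: Qmin.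
have kt0 : 0 < kt by apply/RltP; exact: posdef_eigval Qpos Qmin.1.
have ts0 : 0 < t / s by apply: Rdiv_lt_0_compat; lra.
have ps0 : 0 < p / s by apply: Rdiv_lt_0_compat; lra.
(* The solution is built above m I, and q kt / (q + 1) <= m yields the lower end of the stated
   interval. *)
have [m [m0 [cm [inv con]]]] := contraction_threshold _ _ _ _ _ ts0 ps0 (conj kt0 kt1) Hab.
have c0 : 0 < q * kt / (q + 1).
  have q0 : 0 < q by apply: Rmin_glb_lt.
  by apply: Rdiv_lt_0_compat; [apply: Rmult_lt_0_compat|lra].
apply: (power_equation_solution (kt := kt) (a := a) (b := b) (m := m)) => //.
- exact/RleP.
- apply/RltP; exact: Rlt_le_trans Rlt_0_1 t1.
- apply/RltP; exact: Rlt_le_trans Rlt_0_1 p1.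
- by apply/andP; split; [exact/RltP|exact/RleP].
- by rewrite -!RpowE; exact/RleP.
- by rewrite -!RpowE; exact/RltP.
Qed.
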